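(* Let $\mathbb{P}^x$ and $\tilde{\mathbb{P}}^x$ be the laws on $C([0,\infty),\mathbb{R}^m)$ of the reference SDE $\mathrm{d}X_t=b(X_t)\,\mathrm{d}t+\sigma(X_t)\,\mathrm{d}W_t$, $X_0=x$, and of the surrogate SDE $\mathrm{d}\tilde X_t=\tilde b(\tilde X_t)\,\mathrm{d}t+\sigma(\tilde X_t)\,\mathrm{d}W'_t$, $\tilde X_0=x$, respectively, and let $\phi_\tau(Y)=\int_0^{\tau}f(Y_s)\,\mathrm{d}s$ be a path functional, as in the context. If $\phi_\tau\in L^2(\mathbb{P}^x)\cap L^2(\tilde{\mathbb{P}}^x)$, then $$\bigl|\mathbb{E}^x[\phi_\tau]-\tilde{\mathbb{E}}^x[\phi_\tau]\bigr|\;\le\;\sqrt{\mathbb{E}^x[\phi_\tau^2]+\tilde{\mathbb{E}}^x[\phi_\tau^2]}\;\sqrt{2\,\mathbb{D}_{\mathrm{KL}}\bigl(\mathbb{P}^x\,\|\,\tilde{\mathbb{P}}^x\bigr)}\,.$$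
   Context: Setting. $x\in\mathbb{R}^m$; $b,\tilde b:\mathbb{R}^m\to\mathbb{R}^m$ are drift functions; $\sigma:\mathbb{R}^m\to\mathbb{R}^{m\times n}$ is the diffusion coefficient; $W,W'$ are independent standard $n$-dimensional Brownian motions on a filtered probability space. Put $\Sigma=\sigma\sigma^\top$ and let $A^+$ be the Moore-Penrose pseudoinverse of a matrix $A$. Standing assumptions: the reference SDE has an adapted strong solution that is unique in law and a unique invariant measure $\pi$; there is $\alpha>0$ with $0\le z^\top\Sigma(y)^+z\le\alpha^{-2}\|z\|^2$ for all $y,z\in\mathbb{R}^m$; the difference $b-\tilde b$ is bounded and measurable; the surrogate SDE has a unique weak solution. $\mathbb{E}^x$ and $\tilde{\mathbb{E}}^x$ denote expectation under $\mathbb{P}^x$ and $\tilde{\mathbb{P}}^x$. Path functional. $\tau>0$ is a stopping time for the canonical filtration $(\mathcal{F}_t)_{t\ge0}$ on $C([0,\infty),\mathbb{R}^m)$, $f:\mathbb{R}^m\to\mathbb{R}$ is a function, and $\phi_\tau:C([0,\infty),\mathbb{R}^m)\to\mathbb{R}$, $\phi_\tau(Y)=\int_0^{\tau(Y)}f(Y_s)\,\mathrm{d}s$, is measurable. Divergence. $\mathbb{D}_{\mathrm{KL}}(\mathbb{P}^x\|\tilde{\mathbb{P}}^x)=\int\log\bigl(\frac{\mathrm{d}\mathbb{P}^x}{\mathrm{d}\tilde{\mathbb{P}}^x}\bigr)\,\mathrm{d}\mathbb{P}^x$ is the Kullback-Leibler divergence, with the Radon-Nikodym derivative taken on the stopped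 $\sigma$-algebra $\mathcal{F}_\tau$ (with value $+\infty$ if $\mathbb{P}^x$ is not absolutely continuous with respect to $\tilde{\mathbb{P}}^x$ there). *)

(* Defs.v *)
From HB Require Import structures.
From mathcomp Require Import all_boot all_order all_algebra.
From mathcomp Require Import all_classical all_reals all_analysis.
From mathcomp Require Import measurable_realfun.

Set Implicit Arguments.
Unset Strict Implicit.
Unset Printing Implicit Defensive.

Import Order.TTheory GRing.Theory Num.Theory.
Import numFieldNormedType.Exports.

Local Open Scope classical_set_scope.
Local Open Scope ring_scope.

(* Euclidean norm of a vector; Frobenius norm of a matrix. (The norm `|A| that
   the library puts on matrices is the sup norm.) *)
Definition enorm (R : realType) (p q : nat) (A : 'M[R]_(p, q)) : R :=
  Num.sqrt (\sum_i \sum_j A i j ^+ 2).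

Definition moore_penrose (R : realType) (p q : nat)
    (A : 'M[R]_(p, q)) (X : 'M[R]_(q, p)) : Prop :=
  [/\ A *m X *m A = A, X *m A *m X = X,
      (A *m X)^T = A *m X & (X *m A)^T = X *m A].

(* Existence and uniqueness of the Moore-Penrose inverse are proved below. *)
Definition mp_pinv (R : realType) (p q : nat) (A : 'M[R]_(p, q)) :
  'M[R]_(q, p) := xget 0 (moore_penrose A).

Section moore_penrose_theory.
Variable R : realType.

Lemma mul_trmx_eq0 (q : nat) (u : 'rV[R]_q) : u *m u^T = 0 -> u = 0.
Proof.
move=> /matrixP/(_ 0 0); rewrite !mxE => u0; apply/rowP => j; rewrite mxE.
have /psumr_eq0P /(_ j isT) : \sum_k u 0 k ^+ 2 = 0.
  by rewrite -[RHS]u0; apply: eq_bigr => k _; rewrite mxE expr2.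
move=> /(_ (fun k _ => sqr_ge0 _)) /eqP.
by rewrite sqrf_eq0 => /eqP.
Qed.

Lemma row_free_gram_unit (p q : nat) (F : 'M[R]_(p, q)) :
  row_free F -> F *m F^T \in unitmx.
Proof.
move=> freeF; rewrite -row_free_unit -kermx_eq0; apply/rowV0P => u.
move=> /sub_kermxP uFF; apply: (row_free_inj freeF).
by rewrite mul0mx; apply: mul_trmx_eq0; rewrite trmx_mul mulmxA -(mulmxA u) uFF mul0mx.
Qed.

Lemma moore_penrose_exists (p q : nat) (A : 'M[R]_(p, q)) :
  exists X, moore_penrose A X.
Proof.
have [r [C [F [AE freeC freeF]]]] : exists r (C : 'M[R]_(p, r)) (F : 'M[R]_(r, q)),
    [/\ A = C *m F, row_free C^T & row_free F].
  exists (\rank A), (col_base A), (row_base A); split.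
  - by rewrite mulmx_base.
  - by rewrite /row_free mxrank_tr; exact: col_base_full.
  - exact: row_base_free.
have uF := row_free_gram_unit freeF.
have uC : C^T *m C \in unitmx by rewrite -{2}(trmxK C); exact: row_free_gram_unit.
exists (F^T *m invmx (F *m F^T) *m invmx (C^T *m C) *m C^T).
set G := F *m F^T in uF *; set K := C^T *m C in uC *.
have AX : A *m (F^T *m invmx G *m invmx K *m C^T) = C *m invmx K *m C^T.
  by rewrite AE !mulmxA -(mulmxA C F) -/G -(mulmxA C G) mulmxV // mulmx1.
have XA : F^T *m invmx G *m invmx K *m C^T *m A = F^T *m invmx G *m F.
  by rewrite AE !mulmxA -(mulmxA _ C^T C) -/K -(mulmxA _ _ K) mulVmx // mulmx1.
have tG : G^T = G by rewrite trmx_mul trmxK.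
have tK : K^T = K by rewrite trmx_mul trmxK.
split.
- by rewrite AX AE !mulmxA -(mulmxA _ C^T C) -/K -(mulmxA _ _ K) mulVmx // mulmx1.
- rewrite XA !mulmxA -(mulmxA _ F F^T) -/G -(mulmxA _ _ G) mulVmx //.
  by rewrite mulmx1.
- by rewrite AX !trmx_mul trmxK trmx_inv tK mulmxA.
- by rewrite XA !trmx_mul trmxK trmx_inv tG mulmxA.
Qed.

Lemma moore_penrose_unique (p q : nat) (A : 'M[R]_(p, q)) X Y :
  moore_penrose A X -> moore_penrose A Y -> X = Y.
Proof.
move=> [AXA XAX tAX tXA] [AYA YAY tAY tYA].
have AXY : A *m X = A *m Y.
  rewrite -tAX -{1}AYA -mulmxA trmx_mul tAX tAY.
  by rewrite mulmxA AXA.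
have XAY : X *m A = Y *m A.
  have XAYA : X *m A = X *m A *m (Y *m A) by rewrite -mulmxA (mulmxA A) AYA.
  rewrite -tXA {1}XAYA trmx_mul tYA tXA.
  by rewrite -mulmxA (mulmxA A) AXA.
by rewrite -XAX XAY -mulmxA AXY mulmxA YAY.
Qed.

Lemma mp_pinvP (p q : nat) (A : 'M[R]_(p, q)) : moore_penrose A (mp_pinv A).
Proof. exact: (@xgetPex _ 0 (moore_penrose A) (moore_penrose_exists A)). Qed.

End moore_penrose_theory.

(* R^m with its Borel sigma-algebra (generated by the coordinates). *)
Definition coord_sets (R : realType) (m : nat) : set (set 'cV[R]_m) :=
  [set A | exists i : 'I_m, exists2 B : set R,
     measurable B & A = [set z : 'cV[R]_m | B (z i 0)]].

Definition vec_space (R : realType) (m : nat) : measurableType _ :=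
  g_sigma_algebraType (@coord_sets R m).

(* C([0, oo), R^m): a continuous path on [0, oo) is represented by its unique
   extension to R that is constant on the negative half-line. *)
Record cpath (R : realType) (m : nat) := CPath {
  cpath_fun :> R -> 'cV[R]_m ;
  cpath_continuous : continuous cpath_fun ;
  cpath_past : forall t : R, t <= 0 -> cpath_fun t = cpath_fun 0 }.

Section cpath_instances.
Variables (R : realType) (m : nat).

HB.instance Definition _ := gen_eqMixin (cpath R m).
HB.instance Definition _ := gen_choiceMixin (cpath R m).

Definition cpath0 : cpath R m :=
  @CPath R m (cst 0) (fun x => cvg_cst _) (fun _ _ => erefl).

HB.instance Definition _ := isPointed.Build (cpath R m) cpath0.

End cpath_instances.

(* The events {Y_t^i in B}, t in I, of a process Y with continuous paths. *)
Definition process_sets (R : realType) (m : nat) (T : Type)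
    (Y : T -> cpath R m) (I : set R) : set (set T) :=
  [set A | exists (t : R) (i : 'I_m), exists2 B : set R,
     I t /\ measurable B & A = [set w | B (Y w t i 0)]].

Definition path_space (R : realType) (m : nat) : measurableType _ :=
  g_sigma_algebraType (process_sets (@id (cpath R m)) [set t : R | 0 <= t]).

Definition natural_filtration (R : realType) (m : nat) (T : Type)
    (Y : T -> cpath R m) (t : R) : set (set T) :=
  <<s process_sets Y `[0, t] >>.

Definition canonical_filtration (R : realType) (m : nat) (t : R) :
  set (set (path_space R m)) := natural_filtration (@id (cpath R m)) t.

Definition is_filtration (R : realType) d (T : measurableType d)
    (F : R -> set (set T)) : Prop :=
  (forall t, 0 <= t -> sigma_algebra setT (F t) /\ F t `<=` measurable) /\
  (forall s t, 0 <= s -> s <= t -> F s `<=` F t).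

Definition measurable_wrt (R : realType) (T : Type) (G : set (set T))
    (g : T -> R) : Prop :=
  forall B : set R, measurable B -> G (g @^-1` B).

Definition adapted (R : realType) (m : nat) (T : Type)
    (F : R -> set (set T)) (Y : T -> cpath R m) : Prop :=
  forall t i, 0 <= t -> measurable_wrt (F t) (fun w => Y w t i 0).

Definition progressive (R : realType) (p q : nat) d (T : measurableType d)
    (F : R -> set (set T)) (H : R -> T -> 'M[R]_(p, q)) : Prop :=
  forall (t : R) (i : 'I_p) (j : 'I_q), 0 <= t ->
    measurable_fun
      (`[0, t] `*` setT : set (measurableTypeR R * g_sigma_algebraType (F t)))
      (fun z => H z.1 z.2 i j : R).

(* Standard n-dimensional Brownian motion relative to the filtration F: the
   increment W_t - W_s has independent N(0, t - s) coordinates and is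
   independent of F_s. *)
Definition brownian_motion (R : realType) (n : nat) d (T : measurableType d)
    (Pr : probability T R) (F : R -> set (set T)) (W : T -> cpath R n) : Prop :=
  [/\ adapted F W,
      {ae Pr, forall w, W w 0 = 0},
      (forall (s t : R) (B : 'I_n -> set R), 0 <= s -> s < t ->
         (forall i, measurable (B i)) ->
         Pr [set w | forall i, B i ((W w t - W w s) i 0)] =
         (\prod_(i < n) normal_prob 0 (Num.sqrt (t - s)) (B i))%E) &
      (forall (s t : R) (A : set T) (D : set (vec_space R n)),
         0 <= s -> s < t -> F s A -> measurable D ->
         Pr (A `&` [set w | D (W w t - W w s)]) =
         (Pr A * Pr [set w | D (W w t - W w s)%R])%E)].

Definition independent_processes (R : realType) (n : nat) d
    (T : measurableType d) (Pr : probability T R) (W W' : T -> cpath R n) : Prop :=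
  forall A B : set (path_space R n), measurable A -> measurable B ->
    Pr (W @^-1` A `&` W' @^-1` B) = (Pr (W @^-1` A) * Pr (W' @^-1` B))%E.

(* The filtration generated by W, augmented with the Pr-null events. *)
Definition augmented_filtration (R : realType) (n : nat) d
    (T : measurableType d) (Pr : probability T R) (W : T -> cpath R n) (t : R) :
    set (set T) :=
  <<s process_sets W `[0, t] `|` [set N | measurable N /\ Pr N = 0%E] >>.

(* Simple integrands: sum_(k < K) xi_k 1_{]t_k, t_{k+1}]}, with xi_k bounded and
   F_{t_k}-measurable. *)
Record simple_process (R : realType) (p q : nat) (T : Type)
    (F : R -> set (set T)) := SimpleProcess {
  sp_size : nat ;
  sp_time : nat -> R ;
  sp_val : nat -> T -> 'M[R]_(p, q) ;
  sp_time_ge0 : 0 <= sp_time 0 ;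
  sp_time_nd : forall k, sp_time k <= sp_time k.+1 ;
  sp_bounded : exists M : R, forall k w, enorm (sp_val k w) <= M ;
  sp_measurable : forall k i j,
    measurable_wrt (F (sp_time k)) (fun w => sp_val k w i j) }.

Definition sp_eval (R : realType) (p q : nat) (T : Type)
    (F : R -> set (set T)) (S : simple_process p q F) (t : R) (w : T) :
    'M[R]_(p, q) :=
  \sum_(k < sp_size S)
    \1_(`]sp_time S k, sp_time S k.+1]%classic) t *: sp_val S k w.

Definition sp_integral (R : realType) (p q : nat) (T : Type)
    (F : R -> set (set T)) (W : T -> cpath R q) (S : simple_process p q F)
    (t : R) (w : T) : 'cV[R]_p :=
  \sum_(k < sp_size S) sp_val S k w *m
    (W w (Num.min (sp_time S k.+1) t) - W w (Num.min (sp_time S k) t)).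

Definition cvg0_in_probability (R : realType) d (T : measurableType d)
    (Pr : probability T R) (Z : nat -> T -> \bar R) : Prop :=
  forall e : R, 0 < e ->
    (fun k => Pr [set w | (e%:E <= Z k w)%E]) @ \oo --> 0%E.

(* I is a continuous version of the Ito integral (int_0^t H_s dW_s)_t of a
   progressive integrand H with int_0^t |H_s|^2 ds < oo almost surely: the limit
   in probability of the integrals of simple processes S_k such that
   int_0^t |S_k - H|^2 ds --> 0 in probability. *)
Definition ito_integral (R : realType) (p q : nat) d (T : measurableType d)
    (Pr : probability T R) (F : R -> set (set T)) (W : T -> cpath R q)
    (H : R -> T -> 'M[R]_(p, q)) (I : T -> cpath R p) : Prop :=
  [/\ progressive F H,
      {ae Pr, forall w, forall t, 0 <= t ->
         (\int[lebesgue_measure]_(s in `[0%R, t]) (enorm (H s w) ^+ 2)%:E < +oo)%E},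
      (forall t i, 0 <= t -> measurable_fun setT (fun w => I w t i 0)) &
      exists S : nat -> simple_process p q F, forall t, 0 <= t ->
        cvg0_in_probability Pr (fun k w =>
          \int[lebesgue_measure]_(s in `[0%R, t])
             (enorm (sp_eval (S k) s w - H s w)%R ^+ 2)%:E)%E /\
        cvg0_in_probability Pr (fun k w =>
          (enorm (sp_integral W (S k) t w - I w t))%:E)].

(* X solves dX_t = b(X_t) dt + sigma(X_t) dW_t, X_0 = x, on (T, F, Pr, W). *)
Definition sde_solution (R : realType) (m n : nat) d (T : measurableType d)
    (Pr : probability T R) (F : R -> set (set T)) (W : T -> cpath R n)
    (b : 'cV[R]_m -> 'cV[R]_m) (sigma : 'cV[R]_m -> 'M[R]_(m, n))
    (x : 'cV[R]_m) (X : T -> cpath R m) : Prop :=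
  [/\ adapted F X,
      {ae Pr, forall w, X w 0 = x},
      progressive F (fun s w => b (X w s)),
      {ae Pr, forall w, forall t, 0 <= t ->
         (\int[lebesgue_measure]_(s in `[0%R, t]) (enorm (b (X w s)))%:E < +oo)%E} &
      exists2 I : T -> cpath R m,
        ito_integral Pr F W (fun s w => sigma (X w s)) I &
        {ae Pr, forall w, forall t i, 0 <= t ->
           X w t i 0 = x i 0
             + (\int[lebesgue_measure]_(s in `[0, t]) b (X w s) i 0)
             + I w t i 0}].

Definition has_law (R : realType) (m : nat) d (T : measurableType d)
    (Pr : probability T R) (X : T -> cpath R m)
    (Q : probability (path_space R m) R) : Prop :=
  forall A : set (path_space R m), measurable A -> Q A = Pr (X @^-1` A).

(* A strong solution is adapted to the augmented filtration of the driving
   Brownian motion. *)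
Definition strong_solution (R : realType) (m n : nat) d (T : measurableType d)
    (Pr : probability T R) (W : T -> cpath R n)
    (b : 'cV[R]_m -> 'cV[R]_m) (sigma : 'cV[R]_m -> 'M[R]_(m, n))
    (x : 'cV[R]_m) (X : T -> cpath R m) : Prop :=
  sde_solution Pr (augmented_filtration Pr W) W b sigma x X.

Definition weak_solution_law (R : realType) (m n : nat)
    (b : 'cV[R]_m -> 'cV[R]_m) (sigma : 'cV[R]_m -> 'M[R]_(m, n))
    (x : 'cV[R]_m) (Q : probability (path_space R m) R) : Prop :=
  exists (d : measure_display) (T : measurableType d) (Pr : probability T R)
         (F : R -> set (set T)) (W : T -> cpath R n) (X : T -> cpath R m),
    [/\ is_filtration F, brownian_motion Pr F W,
        sde_solution Pr F W b sigma x X & has_law Pr X Q].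

Definition unique_in_law (R : realType) (m n : nat)
    (b : 'cV[R]_m -> 'cV[R]_m) (sigma : 'cV[R]_m -> 'M[R]_(m, n))
    (x : 'cV[R]_m) : Prop :=
  forall Q1 Q2 : probability (path_space R m) R,
    weak_solution_law b sigma x Q1 -> weak_solution_law b sigma x Q2 ->
    forall A, measurable A -> Q1 A = Q2 A.

(* pi is invariant for the transition kernels p_t(x, A) = P^x(Y_t in A). *)
Definition invariant_distribution (R : realType) (m : nat)
    (P : 'cV[R]_m -> probability (path_space R m) R)
    (pi : probability (vec_space R m) R) : Prop :=
  forall (t : R) (A : set (vec_space R m)), 0 <= t -> measurable A ->
    measurable_fun setT (fun x : vec_space R m => P x [set Y | A (Y t)]) /\
    (\int[pi]_x P x [set Y | A (Y t)] = pi A)%E.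

Definition bounded_measurable (R : realType) (m : nat)
    (g : 'cV[R]_m -> 'cV[R]_m) : Prop :=
  (exists M : R, forall y, enorm (g y) <= M) /\
  measurable_fun setT (g : vec_space R m -> vec_space R m).

Definition stopping_time (R : realType) (m : nat)
    (tau : path_space R m -> \bar R) : Prop :=
  forall t, 0 <= t -> canonical_filtration t [set Y | (tau Y <= t%:E)%E].

Definition stopped_sigma (R : realType) (m : nat)
    (tau : path_space R m -> \bar R) : set (set (path_space R m)) :=
  [set A | measurable A /\ forall t, 0 <= t ->
     canonical_filtration t (A `&` [set Y | (tau Y <= t%:E)%E])].

(* tau may take the value +oo. The integral is real-valued; it is only
   meaningful at the paths Y along which f is integrable. *)
Definition path_functional (R : realType) (m : nat) (f : 'cV[R]_m -> R)
    (tau : path_space R m -> \bar R) (Y : path_space R m) : R :=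
  \int[lebesgue_measure]_(s in [set s : R | 0 <= s /\ (s%:E <= tau Y)%E]) f (Y s).

(* The identity, as a measurable map onto the paths equipped with F_tau: the
   image of P under it is the restriction of P to F_tau. *)
Definition to_stopped (R : realType) (m : nat)
    (tau : path_space R m -> \bar R) (Y : path_space R m) :
  g_sigma_algebraType (stopped_sigma tau) := Y.

Section to_stopped_measurable.
Variables (R : realType) (m : nat) (tau : path_space R m -> \bar R).

Lemma measurable_to_stopped : measurable_fun setT (to_stopped tau).
Proof.
move=> _ A mA; rewrite setTI.
suff : <<s stopped_sigma tau >> `<=` @measurable _ (path_space R m) by apply.
apply: smallest_sub; last by move=> B [].
split; first exact: measurable0.
- by move=> B mB; rewrite setTD; exact: measurableC.
- by move=> B mB; exact: bigcup_measurable.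
Qed.

HB.instance Definition _ :=
  isMeasurableFun.Build _ _ _ _ (to_stopped tau) measurable_to_stopped.

End to_stopped_measurable.

Definition KL (R : realType) d (T : measurableType d) (P Q : probability T R) :
    \bar R :=
  if `[< P `<< Q >]
  then (\int[P]_w lne (Radon_Nikodym (charge_of_finite_measure P) Q w))%E
  else +oo%E.

(* Kullback-Leibler divergence on the stopped sigma-algebra F_tau. *)
Definition KL_stopped (R : realType) (m : nat)
    (tau : path_space R m -> \bar R)
    (P Q : probability (path_space R m) R) : \bar R :=
  KL (distribution P (to_stopped tau)) (distribution Q (to_stopped tau)).

(* Main.v *)
(* Galmarino's test makes phi_tau measurable for the stopped sigma-algebra, so
   both expectations can be computed on F_tau. There, with rho = dP/dQ,
     E_P phi - E_Q phi = int phi (sqrt rho + 1) (sqrt rho - 1) dQ,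
   and Young's inequality together with (sqrt rho + 1)^2 <= 2 (rho + 1) bounds it
   by c (E_P phi^2 + E_Q phi^2) + h / (2 c) for every c > 0, where
   h = int (sqrt rho - 1)^2 dQ is the squared Hellinger distance. Finally h is at
   most the divergence: ln rho >= 2 - 2 / sqrt rho, and the P-integral of the
   right-hand side is h. *)
Require Import Defs.
From HB Require Import structures.
From mathcomp Require Import all_boot all_order all_algebra.
From mathcomp Require Import all_classical all_reals all_analysis.
From mathcomp Require Import measurable_realfun.
From mathcomp Require Import ring lra.

Set Implicit Arguments.
Unset Strict Implicit.
Unset Printing Implicit Defensive.

Import Order.TTheory GRing.Theory Num.Theory.
Import numFieldNormedType.Exports.
Local Open Scope classical_set_scope.
Local Open Scope ring_scope.

(** * Stopped paths and the canonical filtration *)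

Section stopped_paths.
Context {R : realType} {m : nat}.
Implicit Types (Y Z : cpath R m) (s t : R).

Definition stop t Y : R -> 'cV[R]_m := Y \o (fun s => Num.min s t).

Lemma stop_continuous t Y : continuous (stop t Y).
Proof.
move=> s; apply: continuous_comp; last exact: cpath_continuous.
by apply: (@continuous_min R R id (cst t)) => //; exact: cvg_cst.
Qed.

Lemma stop_past t Y s : s <= 0 -> stop t Y s = stop t Y 0.
Proof.
(* The sign of [t] is arbitrary; for [t <= 0] both minima lie in the constant past. *)
move=> s0; rewrite /stop /=; have [t0|t0] := leP t 0.
  by rewrite cpath_past ?[RHS]cpath_past// ge_min ?t0 ?s0 ?orbT.
by rewrite min_l ?cpath_past// (le_trans s0)// ltW.
Qed.

Definition stopped_path t Y : path_space R m :=
  CPath (@stop_continuous t Y) (@stop_past t Y).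

Lemma stopped_pathE t Y s : s <= t -> stopped_path t Y s = Y s.
Proof. by move=> st; rewrite /= /stop /= min_l. Qed.

(** The sets that cannot separate two paths equal on [0, t] form a sigma-algebra containing the
    generators; stating this with an equivalence makes complements immediate. *)
Lemma canonical_filtration_agree t (A : set (path_space R m)) Y Z :
  canonical_filtration t A -> (forall s, 0 <= s <= t -> Y s = Z s) ->
  A Y -> A Z.
Proof.
move=> FA YZ.
suff /(_ A FA Y Z YZ) [] : canonical_filtration t `<=`
    [set A | forall Y Z, (forall s, 0 <= s <= t -> Y s = Z s) -> (A Y <-> A Z)].
  by [].
apply: smallest_sub; first split.
- by [].
- move=> B HB Y' Z' /HB BYZ.
  by split=> -[_ nB]; split=> //; apply: contra_not nB => /BYZ.
- move=> B HB Y' Z' YZ'.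
  by split=> -[n _ Bn]; exists n => //; apply/(HB n _ _ YZ').
- move=> _ [s [i [B [/= sI mB] ->]]] Y' Z' YZ' /=.
  by rewrite YZ'//; move: sI; rewrite in_itv.
Qed.

(** The coordinate at time [s] of the stopped path is the coordinate of the path at [min s t], which
    lies in [0, t], so generators pull back to generators. *)
Lemma canonical_filtration_preimage t (A : set (path_space R m)) : 0 <= t ->
  measurable A -> canonical_filtration t (stopped_path t @^-1` A).
Proof.
move=> t0 mA.
have [F0 FC FU] := smallest_sigma_algebra [set: cpath R m]
  (process_sets (@id (cpath R m)) `[0, t]).
suff /(_ A mA) : @measurable _ (path_space R m) `<=`
    [set A | canonical_filtration t (stopped_path t @^-1` A)] by [].
apply: smallest_sub; first split.
- by rewrite /= preimage_set0.
- by move=> B /= /FC; rewrite !setTD.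
- by move=> B /= /FU; rewrite preimage_bigcup.
- move=> _ [s [i [B [/= s0 mB] ->]]].
  apply: sub_gen_smallest; exists (Num.min s t), i, B => //.
  by split=> //=; rewrite in_itv/= le_min s0 t0 ge_min lexx orbT.
Qed.

(** * Galmarino's test and measurability for the stopped sigma-algebra *)

Context {tau : path_space R m -> \bar R}.
Context (tauP : stopping_time tau) (tau_gt0 : forall Y, (0 < tau Y)%E).

(* Galmarino's test: [tau <= r] only depends on the path up to time [r]. *)
Lemma stopping_time_stopped_path t Y :
  (tau Y <= t%:E)%E -> tau (stopped_path t Y) = tau Y.
Proof.
move=> tauYt.
have agree r : r <= t -> forall s, 0 <= s <= r -> Y s = stopped_path t Y s.
  by move=> rt s /andP[_ sr]; rewrite stopped_pathE// (le_trans sr).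
(* Positivity of [tau] excludes -oo, and the bound by [t] excludes +oo. *)
have [r tauY] : exists r, tau Y = r%:E.
  move: tauYt (tau_gt0 Y); case: (tau Y) => [r| |] //; first by exists r.
have r0 : 0 <= r by move: (tau_gt0 Y); rewrite tauY lte_fin => /ltW.
have rt : r <= t by rewrite -lee_fin -tauY.
have le1 : (tau (stopped_path t Y) <= r%:E)%E.
  apply: (@canonical_filtration_agree _ [set Z | (tau Z <= r%:E)%E] _ _
    (tauP r0) (agree _ rt)).
  by rewrite /= tauY.
apply/eqP; rewrite eq_le {1}tauY le1/=.
(* For the reverse inequality, the event [tau <= r'] is carried back from the stopped path to [Y],
   which is possible because [r' <= r <= t]. *)
have [r' tauS] : exists r', tau (stopped_path t Y) = r'%:E.
  move: le1 (tau_gt0 (stopped_path t Y)).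
  by case: (tau (stopped_path t Y)) => [q| |] //; exists q.
have r'0 : 0 <= r'.
  by move: (tau_gt0 (stopped_path t Y)); rewrite tauS lte_fin => /ltW.
have r't : r' <= t by rewrite (le_trans _ rt)// -lee_fin -tauS.
rewrite tauS.
apply: (@canonical_filtration_agree _ [set Z | (tau Z <= r'%:E)%E] _ _
  (tauP r'0)
  (fun s hs => esym (agree _ r't s hs))).
by rewrite /= tauS.
Qed.

Lemma path_functional_stopped_path (f : 'cV[R]_m -> R) t Y :
  (tau Y <= t%:E)%E ->
  path_functional f tau (stopped_path t Y) = path_functional f tau Y.
Proof.
move=> tauYt; rewrite /path_functional stopping_time_stopped_path//.
rewrite /Rintegral; congr fine; apply: eq_integral => s; rewrite inE => -[_ stau].
by rewrite stopped_pathE// -lee_fin (le_trans stau).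
Qed.

(** On [tau <= t] the functional takes the same value at [Y] and at its stopped path, so there an
    event of the functional is a preimage under [stopped_path t], which belongs to F_t. *)
Lemma measurable_path_functional_stopped (f : 'cV[R]_m -> R) :
  measurable_fun setT (path_functional f tau) ->
  measurable_fun [set: g_sigma_algebraType (stopped_sigma tau)]
    (path_functional f tau).
Proof.
move=> mphi _ B mB; rewrite setTI; apply: sub_gen_smallest; split.
  by rewrite -[X in measurable X]setTI; exact: mphi.
move=> t t0.
have -> : path_functional f tau @^-1` B `&` [set Y | (tau Y <= t%:E)%E] =
    stopped_path t @^-1` (path_functional f tau @^-1` B)
    `&` [set Y | (tau Y <= t%:E)%E].
  by apply/seteqP; split=> Y /= [BY tY]; split=> //; move: BY;
    rewrite path_functional_stopped_path.
apply: (@measurableI _ (g_sigma_algebraType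
  (process_sets (@id (cpath R m)) `[0, t]))); last exact: tauP.
apply: canonical_filtration_preimage => //.
by rewrite -[X in measurable X]setTI; exact: mphi.
Qed.

End stopped_paths.

(** * Scalar inequalities *)

(** This is ln (1 + u) <= u at u = 1 / sqrt y - 1, together with ln y = 2 ln (sqrt y). *)
Lemma ln_ge_sqrt (R : realType) (y : R) : 0 < y ->
  2 - 2 * (Num.sqrt y)^-1 <= ln y.
Proof.
move=> y0; have s0 : 0 < Num.sqrt y by rewrite sqrtr_gt0.
have -> : ln y = 2 * ln (Num.sqrt y).
  by rewrite -{1}(sqr_sqrtr (ltW y0)) lnXn// mulr_natl.
have := @le_ln1Dx R ((Num.sqrt y)^-1 - 1).
have -> : 1 + ((Num.sqrt y)^-1 - 1) = (Num.sqrt y)^-1 by ring.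
rewrite lnV ?posrE// ltrBrDl subrr invr_gt0 s0 => /(_ isT).
by lra.
Qed.

(** Pointwise form of the main estimate, to be integrated against Q with [a = phi w] and
    [y = rho w]. *)
Lemma young_density (R : realType) (c a y : R) : 0 < c -> 0 <= y ->
  `|a * y - a| <=
    c * (a ^+ 2 * y + a ^+ 2) + (2 * c)^-1 * (Num.sqrt y - 1) ^+ 2.
Proof.
move=> c0 y0; set s := Num.sqrt y.
have -> : y = s ^+ 2 by rewrite sqr_sqrtr.
have cc : c * (2 * c)^-1 = 2^-1 by field; rewrite gt_eqF.
set k := (2 * c)^-1 in cc *.
have k0 : 0 < k by rewrite invr_gt0 mulr_gt0.
(* The square behind Young's inequality; [e = 1] and [e = -1] bound both signs. *)
have sq (e : R) : 0 <= c * (a * (s + 1) - e * (2 * k) * (s - 1)) ^+ 2.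
  by rewrite mulr_ge0 ?sqr_ge0// ltW.
(* This one is [(s + 1) ^+ 2 <= 2 * (s ^+ 2 + 1)]. *)
have sq' : 0 <= c * (a * (s - 1)) ^+ 2.
  by rewrite mulr_ge0 ?sqr_ge0// ltW.
have E1 (e : R) : e ^+ 2 = 1 ->
   c * (a * (s + 1) - e * (2 * k) * (s - 1)) ^+ 2 =
   c * (a * (s + 1)) ^+ 2 - 2 * e * (a * s ^+ 2 - a) + 2 * k * (s - 1) ^+ 2.
  move=> e2.
  have -> : c * (a * (s + 1) - e * (2 * k) * (s - 1)) ^+ 2 =
   c * (a * (s + 1)) ^+ 2 - 4 * (c * k) * e * (a * s ^+ 2 - a)
    + e ^+ 2 * (4 * (c * k) * k) * (s - 1) ^+ 2 by ring.
  by rewrite cc e2; field.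
have h1 := sq 1; have h2 := sq (-1).
rewrite E1 ?sqrrN ?expr1n// in h1; rewrite E1 ?sqrrN ?expr1n// in h2.
by rewrite ler_norml; apply/andP; split; nra.
Qed.

(** Eliminates the free parameter [c] of Young's inequality. *)
Lemma sqr_le_of_young (R : realType) (d S h : R) : 0 <= d -> 0 <= S -> 0 <= h ->
  (forall c, 0 < c -> d <= c * S + (2 * c)^-1 * h) -> d ^+ 2 <= 2 * S * h.
Proof.
move=> d0 S0 h0 H; have [->|dn0] := eqVneq d 0.
  by rewrite expr0n/= !mulr_ge0.
have {dn0} dp : 0 < d by rewrite lt_neqAle eq_sym dn0.
have [SE|Sn0] := eqVneq S 0.
  (* For [S = 0] this [c] is large enough to make the bound smaller than [d], a contradiction. *)
  have c0 : 0 < (h + 1) / d by rewrite divr_gt0// ltr_wpDl.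
  have := H _ c0; rewrite SE mulr0 add0r => Hd.
  have : 2 * (h + 1) <= h.
    rewrite -(ler_pM2l dp) (le_trans _ (_ : 2 * (h + 1) * ((2 * ((h + 1) / d))^-1 * h) <= _))//.
      by rewrite mulrC ler_pM2l// mulr_gt0// ltr_wpDl.
    rewrite (_ : 2 * (h + 1) * _ = d * h)//; field.
    by rewrite !gt_eqF// ltr_wpDl.
  by lra.
have {Sn0} Sp : 0 < S by rewrite lt_neqAle eq_sym Sn0.
(* The minimizer sqrt (h / (2 S)) would vanish for [h = 0]; this positive choice already gives d <=
   d / 2 + S h / d. *)
have c0 : 0 < d / (2 * S) by rewrite divr_gt0// mulr_gt0.
have := H _ c0.
have -> : d / (2 * S) * S = d / 2 by field; rewrite gt_eqF.
have -> : (2 * (d / (2 * S)))^-1 = S / d by field; rewrite !gt_eqF.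
rewrite -(ler_pM2l dp) => Hd.
have : d * (d / 2 + S / d * h) = d ^+ 2 / 2 + S * h by field; rewrite gt_eqF.
by move=> E; rewrite E in Hd; lra.
Qed.

(** * Densities, Hellinger distance and divergence *)

Section probability_measures.
Local Open Scope ereal_scope.
Context {R : realType} {d : measure_display} {T : measurableType d}.
Implicit Types P Q : probability T R.

Lemma measurable_sqrt : measurable_fun setT (@Num.sqrt R).
Proof. by apply: continuous_measurable_fun; exact: sqrt_continuous. Qed.

Lemma integral_cst_prob P (c : R) : \int[P]_w c%:E = c%:E.
Proof.
by rewrite (integral_cst P measurableT c%:E) [X in _ * X](probability_setT P) mule1.
Qed.

(** Serves for a log-density [g] whose integral may be +oo: positive and negative parts are compared
    separately. *)
Lemma le_integral_lower P (g h : T -> \bar R) :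
  measurable_fun setT g -> P.-integrable setT h ->
  {ae P, forall w, h w <= g w} -> \int[P]_w h w <= \int[P]_w g w.
Proof.
move=> mg ih hg; have mh := measurable_int _ ih.
rewrite integralE [leRHS]integralE leeB//; apply: ae_ge0_le_integral => //;
  try exact: measurable_funepos; try exact: measurable_funeneg.
- by apply: filterS hg => w hgw _; rewrite !funeposE le_max2.
- by apply: filterS hg => w hgw _; rewrite !funenegE le_max2// leeN2.
Qed.

(** Provides a version of dP/dQ that is real and nonnegative at every point, so that square roots
    and pointwise inequalities apply everywhere. *)
Lemma probability_density P Q : P `<< Q -> exists rho : T -> R,
  [/\ measurable_fun setT rho, (forall w, 0 <= rho w)%R,
      (forall h : T -> R, measurable_fun setT h -> (forall w, 0 <= h w)%R ->
         \int[Q]_w (h w * rho w)%:E = \int[P]_w (h w)%:E),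
      ae_eq Q setT (EFin \o rho) (Radon_Nikodym (charge_of_finite_measure P) Q)
    & {ae P, forall w, (0 < rho w)%R}].
Proof.
move=> PQ; pose f := Radon_Nikodym_SigmaFinite.f P Q.
have f0 := Radon_Nikodym_SigmaFinite.f_ge0 PQ.
have ffin := Radon_Nikodym_SigmaFinite.f_fin_num PQ.
have fE : EFin \o (fine \o f) = f by apply/funext => w /=; rewrite fineK// ffin.
have mrho : measurable_fun setT (fine \o f).
  apply/measurable_EFinP; rewrite fE.
  exact: measurable_int (Radon_Nikodym_SigmaFinite.f_integrable PQ).
exists (fine \o f); split => //.
- by move=> w; exact/fine_ge0/f0.
- move=> h mh h0.
  rewrite -(Radon_Nikodym_SigmaFinite.change_of_variables PQ (f := EFin \o h))//.
  + by apply: eq_integral => w _; rewrite EFinM /= fineK// ffin.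
  + exact/measurable_EFinP.
- by rewrite fE; exact: ae_eq_Radon_Nikodym_SigmaFinite.
(* The P-mass of the zero set of the density is the Q-integral of the density over that set, hence
   zero. *)
- have mZ : measurable [set w | (fine \o f) w = 0%R].
    by rewrite -[X in measurable X]setTI; exact: (mrho measurableT [set 0%R]).
  exists [set w | (fine \o f) w = 0%R]; split => //.
    rewrite [LHS](Radon_Nikodym_SigmaFinite.f_integral PQ)//.
    apply: integral0_eq => w; rewrite /= => fw0.
    by rewrite -[LHS]fineK ?ffin// fw0.
  move=> w /= /negP; rewrite -leNgt => fw.
  by apply/eqP; rewrite eq_le fw; exact/fine_ge0/f0.
Qed.


Section density.
Context {P Q : probability T R} {rho : T -> R}.
Context (PQ : P `<< Q) (mrho : measurable_fun setT rho)
  (rho0 : forall w, (0 <= rho w)%R)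
  (rhoE : forall h : T -> R, measurable_fun setT h -> (forall w, 0 <= h w)%R ->
     \int[Q]_w (h w * rho w)%:E = \int[P]_w (h w)%:E)
  (rhoRN : ae_eq Q setT (EFin \o rho)
     (Radon_Nikodym (charge_of_finite_measure P) Q)).

(** With a = int sqrt rho dQ, the squared distance is 2 - 2 a. Since a is also the P-integral of 1 /
    sqrt rho, this is the P-integral of the lower bound 2 - 2 / sqrt rho of ln rho. *)
Lemma hellinger_le_KL : {ae P, forall w, (0 < rho w)%R} ->
  \int[Q]_w ((Num.sqrt (rho w) - 1) ^+ 2)%:E <= KL P Q.
Proof.
move=> rho_gt0.
pose s (w : T) : R := Num.sqrt (rho w).
have ms : measurable_fun setT s.
  exact: measurableT_comp measurable_sqrt mrho.
have s0 w : (0 <= s w)%R by exact: sqrtr_ge0.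
have s2 w : (s w ^+ 2 = rho w)%R by rewrite sqr_sqrtr.
set H := leLHS.
have H0 : 0 <= H by apply: integral_ge0 => w _; rewrite lee_fin sqr_ge0.
set a := \int[Q]_w (s w)%:E.
have a0 : 0 <= a by apply: integral_ge0 => w _; rewrite lee_fin.
have mH : measurable_fun setT (fun w => ((s w - 1) ^+ 2)%:E).
  by apply/measurable_EFinP; apply: measurable_funX; exact: measurable_funB.
(* (s - 1)^2 + 2 s = rho + 1, and both terms have Q-integral 1. The identity is kept additive
   because [a] is not yet known to be finite. *)
have HaE : H + 2%:E * a = 2%:E.
  rewrite -ge0_integralZl_EFin//; last 2 first.
  - by move=> w _; rewrite lee_fin.
  - exact/measurable_EFinP.
  rewrite -ge0_integralD//; last 3 first.
  - by move=> w _; rewrite lee_fin sqr_ge0.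
  - by move=> w _; rewrite -EFinM lee_fin mulr_ge0.
  - by apply: emeasurable_funM => //; exact/measurable_EFinP.
  under eq_integral => w _.
    rewrite -EFinM -EFinD.
    rewrite (_ : (_ + _)%R = 1 * rho w + 1)%R; last first.
      by rewrite -[Num.sqrt _]/(s w) -s2; ring.
    rewrite EFinD; over.
  rewrite ge0_integralD//; last 2 first.
  - by move=> w _; rewrite lee_fin mul1r.
  - by apply/measurable_EFinP; exact: measurable_funM.
  rewrite (rhoE (h := cst 1%R))// !integral_cst_prob.
  by rewrite -EFinD; congr EFin; ring.
have a_fin : a \is a fin_num.
  rewrite ge0_fin_numE// ltNge leye_eq; apply/negP => /eqP aoo.
  by move: HaE; rewrite aoo gt0_muley ?lte_fin// addey// gt_eqF// (lt_le_trans _ H0).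
have HE : H = 2%:E - 2%:E * a by rewrite -[X in _ = X - _]HaE addeK// fin_numM.
(* At [rho w = 0] both [k w] and [(s w)^-1] are the junk value [0]. *)
pose k w := (rho w `^ - 2^-1)%R.
have kE w : k w = (s w)^-1%R by rewrite /k powRN powR12_sqrt.
have mk : measurable_fun setT k.
  exact: (measurableT_comp (measurable_powR (R := R) (- 2^-1)) mrho).
have k0 w : (0 <= k w)%R by exact: powR_ge0.
have int_k : \int[P]_w (k w)%:E = a.
  rewrite -rhoE//; apply: eq_integral => w _; congr EFin.
  rewrite kE -s2 expr2 mulrA; have [->|sn0] := eqVneq (s w) 0%R.
    by rewrite mulr0.
  by rewrite mulVf// mul1r.
have ik : P.-integrable setT (EFin \o k).
  apply/integrableP; split; first exact/measurable_EFinP.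
  under eq_integral => w _ do rewrite gee0_abs ?lee_fin//.
  by rewrite int_k -ge0_fin_numE.
have icst : P.-integrable setT (cst (2%:E : \bar R)).
  by apply: finite_measure_integrable_cst.
have i2k := integrableZl measurableT 2 ik.
rewrite /KL; case: asboolP => // _.
rewrite HE -int_k -integralZl// -[X in X - _](integral_cst_prob P) -integralB//.
apply: le_integral_lower.
(* The derivative is finite everywhere, so measurability of [lne] is only needed on the reals. *)
- set g := Radon_Nikodym _ _.
  have gE : @lne R \o g = (fun r : R => lne r%:E) \o (fine \o g).
    apply/funext => w; apply: (congr1 (@lne R)); apply/esym/fineK.
    exact: Radon_Nikodym_fin_num.
  rewrite [X in measurable_fun _ X]gE; apply: measurableT_comp.
    apply: measurable_fun_ifT => //; first exact: measurable_fun_ler.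
    by apply/measurable_EFinP; exact: measurable_ln.
  apply: measurableT_comp; first exact: fine_measurable.
  by apply: measurable_int; exact: Radon_Nikodym_integrable.
- exact: integrableB.
(* The Q-almost everywhere equality of the two densities passes to P by absolute continuity. *)
- have := null_dominates_ae_eq measurableT PQ rhoRN.
  apply: filterS2 rho_gt0 => w rw /(_ I) /= <-.
  by rewrite lne_EFin// lee_fin kE; exact: ln_ge_sqrt.
Qed.

Lemma expectation_gap_young (phi : T -> R) (c : R) :
  P.-integrable setT (EFin \o phi) -> Q.-integrable setT (EFin \o phi) ->
  (0 < c)%R ->
  `| \int[P]_w (phi w)%:E - \int[Q]_w (phi w)%:E | <=
    c%:E * (\int[P]_w (phi w ^+ 2)%:E + \int[Q]_w (phi w ^+ 2)%:E)
    + ((2 * c)^-1)%:E * \int[Q]_w ((Num.sqrt (rho w) - 1) ^+ 2)%:E.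
Proof.
move=> iP iQ c0.
have mphi : measurable_fun setT phi by apply/measurable_EFinP/(measurable_int P).
have mphi2 : measurable_fun setT (fun w => phi w ^+ 2)%R by exact: measurable_funX.
have mphir : measurable_fun setT (fun w => phi w * rho w)%R.
  exact: measurable_funM.
have ir : Q.-integrable setT (fun w => (phi w * rho w)%:E).
  apply/integrableP; split; first exact/measurable_EFinP.
  under eq_integral => w _ do rewrite abse_EFin normrM (ger0_norm (rho0 w)).
  rewrite (rhoE (h := fun w => `|phi w|%R))//; first by case/integrableP: iP.
  exact: measurableT_comp.
(* [phi] is signed while [rhoE] covers nonnegative functions, hence the change of variables for
   integrable functions. *)
have -> : \int[P]_w (phi w)%:E = \int[Q]_w (phi w * rho w)%:E.
  rewrite -(Radon_Nikodym_change_of_variables PQ measurableT iP).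
  apply: ae_eq_integral => //.
  - apply: emeasurable_funM; first exact/measurable_EFinP.
    by apply: measurable_int; exact: Radon_Nikodym_integrable.
  - exact/measurable_EFinP.
  - by apply: filterS rhoRN => w /(_ I) /= <- _; rewrite EFinM.
rewrite -integralB//; apply: (le_trans (le_abse_integral _ _ _)) => //.
  by apply: emeasurable_funB; exact/measurable_EFinP.
pose s (w : T) : R := ((Num.sqrt (rho w) - 1) ^+ 2)%R.
have ms : measurable_fun setT s.
  apply: measurable_funX; apply: measurable_funB => //.
  exact: measurableT_comp measurable_sqrt mrho.
(* From here the right-hand side is gathered into a single Q-integral, to be compared pointwise. *)
rewrite -(rhoE (h := fun w => (phi w ^+ 2)%R))//; last by move=> w; rewrite sqr_ge0.
have mA : measurable_fun setT (fun w => (phi w ^+ 2 * rho w)%:E).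
  by apply/measurable_EFinP; exact: measurable_funM.
have mB : measurable_fun setT (fun w => (phi w ^+ 2)%:E).
  exact/measurable_EFinP.
rewrite -ge0_integralD//; last 2 first.
- by move=> w _; rewrite lee_fin mulr_ge0 ?sqr_ge0.
- by move=> w _; rewrite lee_fin sqr_ge0.
have k0 : (0 <= (2 * c)^-1)%R by rewrite invr_ge0 mulr_ge0// ltW.
rewrite -ge0_integralZl_EFin//; last 3 first.
- by move=> w _; rewrite -EFinD lee_fin addr_ge0 ?sqr_ge0// mulr_ge0 ?sqr_ge0.
- exact: emeasurable_funD.
- exact: ltW.
rewrite -ge0_integralZl_EFin//; last 2 first.
- by move=> w _; rewrite lee_fin sqr_ge0.
- exact/measurable_EFinP.
have mL : measurable_fun setT
    (fun w => c%:E * ((phi w ^+ 2 * rho w)%:E + (phi w ^+ 2)%:E)).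
  apply: emeasurable_funM => //.
  exact: emeasurable_funD.
have mR : measurable_fun setT (fun w => ((2 * c)^-1)%:E * (s w)%:E).
  by apply: emeasurable_funM => //; exact/measurable_EFinP.
rewrite -ge0_integralD//; last 2 first.
- by move=> w _; rewrite -EFinD -EFinM lee_fin mulr_ge0 ?(ltW c0)//
    addr_ge0 ?sqr_ge0// mulr_ge0 ?sqr_ge0.
- by move=> w _; rewrite -EFinM lee_fin mulr_ge0// sqr_ge0.
apply: ge0_le_integral => //.
- apply: measurableT_comp => //.
  by apply: emeasurable_funB; exact/measurable_EFinP.
- exact: emeasurable_funD.
- by move=> w _; rewrite lee_fin; exact: young_density.
Qed.

End density.

(** * The inequality for two probability measures *)

Lemma expectation_gap_le_KL P Q (phi : T -> R) :
  P.-integrable setT (EFin \o phi) -> Q.-integrable setT (EFin \o phi) ->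
  P.-integrable setT (fun w => (phi w ^+ 2)%:E) ->
  Q.-integrable setT (fun w => (phi w ^+ 2)%:E) ->
  `| \int[P]_w (phi w)%:E - \int[Q]_w (phi w)%:E | <=
    sqrte (\int[P]_w (phi w ^+ 2)%:E + \int[Q]_w (phi w ^+ 2)%:E)
    * sqrte (2%:E * KL P Q).
Proof.
move=> iP iQ iP2 iQ2.
have mphi : measurable_fun setT phi by apply/measurable_EFinP/(measurable_int P).
have p0 : 0 <= \int[P]_w (phi w ^+ 2)%:E.
  by apply: integral_ge0 => w _; rewrite lee_fin sqr_ge0.
have q0 : 0 <= \int[Q]_w (phi w ^+ 2)%:E.
  by apply: integral_ge0 => w _; rewrite lee_fin sqr_ge0.
set D := _ - _; set S := _ + \int[Q]_w (phi w ^+ 2)%:E.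
have S0 : 0 <= S by exact: adde_ge0.
have Sfin : S \is a fin_num by rewrite fin_numD !integrable_fin_num.
have Dfin : D \is a fin_num by rewrite fin_numB !integrable_fin_num.
have null (M : probability T R) : \int[M]_w (phi w ^+ 2)%:E = 0 ->
    \int[M]_w (phi w)%:E = 0.
  move=> M0; transitivity (\int[M]_w (cst 0 w : \bar R)); last exact: integral0.
  apply: ae_eq_integral => //; first exact/measurable_EFinP.
  have m2 : measurable_fun setT (fun w => (phi w ^+ 2)%:E).
    by apply/measurable_EFinP; exact: measurable_funX.
  have /(ae_eq_integral_abs M measurableT m2) : \int[M]_w `|(phi w ^+ 2)%:E| = 0.
    by rewrite -[RHS]M0; apply: eq_integral => w _; rewrite gee0_abs// lee_fin sqr_ge0.
  apply: filterS => w /(_ I) /= [/eqP]; rewrite sqrf_eq0 => /eqP -> _ //.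
(* This case is separate because 0 * +oo = 0: the bound is then 0 even for infinite divergence, and
   [phi] vanishes almost everywhere under both measures. *)
have [S_eq0|Sn0] := eqVneq S 0.
  move: (S_eq0); rewrite /S => /eqP; rewrite padde_eq0// => /andP[/eqP P0 /eqP Q0].
  by rewrite /D !null// sube0 abse0 mule_ge0 ?sqrte_ge0.
have Sgt0 : 0 < S by rewrite lt_neqAle eq_sym Sn0.
have [KLoo|KLn] := eqVneq (KL P Q) +oo.
  rewrite KLoo gt0_muley ?lte_fin// [X in _ * X]/= gt0_muley ?leey//.
  rewrite lt_neqAle sqrte_ge0 andbT eq_sym.
  apply: contra Sn0 => /eqP r0.
  by rewrite -(sqr_sqrte S0) r0 expe2 mul0e.
(* A divergence other than +oo excludes the default branch of [KL]. *)
have PQ : P `<< Q by move: KLn; rewrite /KL; case: asboolP => //; rewrite eqxx.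
have [rho [mrho rho0 rhoE rhoRN rho_gt0]] := probability_density PQ.
have HKL := hellinger_le_KL PQ mrho rho0 rhoE rhoRN rho_gt0.
have gap := expectation_gap_young PQ mrho rho0 rhoE rhoRN iP iQ.
set h := \int[Q]_w ((Num.sqrt (rho w) - 1) ^+ 2)%:E in HKL gap.
have h0 : 0 <= h by apply: integral_ge0 => w _; rewrite lee_fin sqr_ge0.
have KL0 : 0 <= KL P Q by exact: le_trans HKL.
have KLfin : KL P Q \is a fin_num by rewrite ge0_fin_numE// ltey.
have hfin : h \is a fin_num.
  by rewrite ge0_fin_numE// (le_lt_trans HKL)// ltey.
rewrite -/S -/D in gap.
(* All quantities are now finite, so squares are compared in the reals: D^2 <= 2 S h <= S (2 KL). *)
rewrite -sqrteM// -sqrte_sqr; rewrite lee_sqrt; last by rewrite !mule_ge0.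
have {}gap (c : R) : (0 < c)%R ->
    (`|fine D| <= c * fine S + (2 * c)^-1 * fine h)%R.
  by move=> /gap; rewrite -{1}(fineK Dfin) -{1}(fineK Sfin) -{1}(fineK hfin).
have := sqr_le_of_young (normr_ge0 _) (fine_ge0 S0) (fine_ge0 h0) gap.
rewrite real_normK ?num_real// => Dle.
rewrite -(fineK Dfin) -(fineK Sfin) -(fineK KLfin) expe2 -!EFinM lee_fin -expr2.
apply: (le_trans Dle); rewrite mulrCA -mulrA ler_pM2l// ler_wpM2l ?fine_ge0//.
by rewrite fine_le.
Qed.

End probability_measures.

(** * Passage to the stopped sigma-algebra *)

Theorem lemma3p1 (R : realType) (m n : nat)
  (b bt : 'cV[R]_m -> 'cV[R]_m) (sigma : 'cV[R]_m -> 'M[R]_(m, n))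
  (* the filtered probability space and the driving Brownian motions *)
  (d : measure_display) (Omega : measurableType d) (Pr : probability Omega R)
  (F : R -> set (set Omega)) (W W' : Omega -> cpath R n)
  (hF : is_filtration F)
  (hW : brownian_motion Pr F W) (hW' : brownian_motion Pr F W')
  (hWW' : independent_processes Pr W W')
  (* the laws P^x of the reference SDE and Pt^x of the surrogate SDE *)
  (P Pt : 'cV[R]_m -> probability (path_space R m) R)
  (hP : forall x, exists2 X : Omega -> cpath R m,
     strong_solution Pr W b sigma x X & has_law Pr X (P x))
  (hP_unique : forall x, unique_in_law b sigma x)
  (hPt : forall x, weak_solution_law bt sigma x (Pt x))
  (hPt_unique : forall x, unique_in_law bt sigma x)
  (* the unique invariant measure of the reference SDE *)
  (pi : probability (vec_space R m) R) (hpi : invariant_distribution P pi)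
  (hpi_unique : forall pi' : probability (vec_space R m) R,
     invariant_distribution P pi' ->
     forall A, measurable A -> pi' A = pi A)
  (alpha : R) (halpha : 0 < alpha)
  (hSigma : forall y z : 'cV[R]_m,
     0 <= (z^T *m mp_pinv (sigma y *m (sigma y)^T) *m z) 0 0
       <= alpha ^- 2 * enorm z ^+ 2)
  (hb : bounded_measurable (fun y => b y - bt y))
  (x : 'cV[R]_m)
  (tau : path_space R m -> \bar R) (htau : stopping_time tau)
  (htau_gt0 : forall Y, (0 < tau Y)%E)
  (f : 'cV[R]_m -> R)
  (* phi_tau is well defined almost surely, and measurable *)
  (hf : {ae P x, forall Y : path_space R m, lebesgue_measure.-integrable
     [set s : R | 0 <= s /\ (s%:E <= tau Y)%E] (EFin \o (fun s => f (Y s)))})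
  (hft : {ae Pt x, forall Y : path_space R m, lebesgue_measure.-integrable
     [set s : R | 0 <= s /\ (s%:E <= tau Y)%E] (EFin \o (fun s => f (Y s)))})
  (hphi : measurable_fun setT (path_functional f tau))
  (hphi2 : path_functional f tau \in Lfun (P x) 2%:E)
  (hphi2t : path_functional f tau \in Lfun (Pt x) 2%:E) :
  (`| 'E_(P x)[path_functional f tau] - 'E_(Pt x)[path_functional f tau] |
   <= sqrte ('E_(P x)[fun Y => (path_functional f tau Y ^+ 2)%R]
             + 'E_(Pt x)[fun Y => (path_functional f tau Y ^+ 2)%R])
      * sqrte (2%:E * KL_stopped tau (P x) (Pt x)))%E.
Proof.
have mphi := measurable_path_functional_stopped htau htau_gt0 hphi.
set phi := path_functional f tau in hphi2 hphi2t mphi *.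
have mphi2 : measurable_fun [set: g_sigma_algebraType (stopped_sigma tau)]
    (fun Y => (phi Y ^+ 2)%:E).
  by apply/measurable_EFinP; exact: measurable_funX.
have mphi1 : measurable_fun [set: g_sigma_algebraType (stopped_sigma tau)]
    (EFin \o phi) by exact/measurable_EFinP.
have L1 (M : probability (path_space R m) R) : phi \in Lfun M 2%:E ->
    M.-integrable setT (EFin \o phi).
  by move=> M2; apply/Lfun1_integrable/Lfun_subset12 => //; exact: fin_num_measure.
(* [D M] is the restriction of [M] to F_tau. As [to_stopped] is the identity, moments of [phi] under
   [M] and under [D M] coincide. *)
pose D (M : probability (path_space R m) R) := distribution M (to_stopped tau).
have i1 (M : probability (path_space R m) R) : phi \in Lfun M 2%:E ->
    (D M).-integrable setT (EFin \o phi).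
  by move=> M2; apply: integrable_pushforward => //; exact: L1.
have i2 (M : probability (path_space R m) R) : phi \in Lfun M 2%:E ->
    (D M).-integrable setT (fun Y => (phi Y ^+ 2)%:E).
  move=> M2; apply: integrable_pushforward => //.
  exact: Lfun2_integrable_sqr.
have E1 (M : probability (path_space R m) R) : phi \in Lfun M 2%:E ->
    ('E_M[phi] = \int[D M]_Y (phi Y)%:E)%E.
  move=> M2; rewrite unlock.
  by rewrite (integral_distribution (X := to_stopped tau) mphi1 (L1 _ M2)).
have E2 (M : probability (path_space R m) R) : phi \in Lfun M 2%:E ->
    ('E_M[fun Y => (phi Y ^+ 2)%R] = \int[D M]_Y (phi Y ^+ 2)%:E)%E.
  move=> M2; rewrite unlock.
  by rewrite (integral_distribution (X := to_stopped tau) mphi2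
    (Lfun2_integrable_sqr M2)).
rewrite !E1// !E2//; apply: expectation_gap_le_KL; by [exact: i1|exact: i2].
Qed.
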